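(* Let $G$ be an infinite finitely generated nilpotent group. Then the set $SAT(G,1)\subseteq G_X$ (where $X=\{x_1\}$) of one-variable equations satisfiable in $G$ is negligible, i.e. $\lim_{n\to\infty}\rho_n(SAT(G,1))=0$, where $\rho_n$ denotes the frequency in balls of $G_X$ with respect to the norm $\|\cdot\|$ coming from a lower central base $e$ of $G_X$ extending a lower central base of $G$ (as described in the context).
   Context: $\gamma_i(H)$ denotes the $i$-th term of the lower central series of a group $H$ ($\gamma_1(H)=H$, $\gamma_{i+1}(H)=[\gamma_i(H),H]$). Let $c$ be the nilpotency class of $G$ and $G_i=\gamma_i(G)$. Let $k\ge1$ (here $k=1$). **Space of equations.** Let $X=\{x_1,\dots,x_k\}$, let $F(X)$ be the free group on $X$, and let $N_c(X)=F(X)/\gamma_{c+1}(F(X))$ be the free nilpotent group of class $c$ on $X$. Put $G_X=(G*N_c(X))/\gamma_{c+1}(G*N_c(X))$, the free product of $G$ and $N_c(X)$ in the variety of nilpotent groups of class $\le c$. $G$ and $N_c(X)$ embed naturally in $G_X$. Elements $u\in G_X$ are viewed as equations $u=1$ in variables $x_1,\dots,x_k$ with coefficients in $G$. $SAT(G,k)\subseteq G_X$ is the set of $u$ for which $u=1$ has a solution in $G$, i.e. there are $h_1,\dots,h_k\in G$ such that the homomorphism $G_X\to G$ that is the identity on $G$ and sends $x_j\mapsto h_j$ maps $u$ to $1$. **Bases.** A base of a finitely generated abelian group $C$ is a tuple $(c_1,\dots,c_s,c'_1,\dots,c'_t)$ such that $C$ is the direct product of the cyclic subgroups generated by these elements,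 where the $c_i$ have infinite order and the $c'_j$ have finite orders. For each $i=1,\dots,c$ let $d_i$ be a tuple of elements of $G_i$ whose image in $G_i/G_{i+1}$ is a base of $G_i/G_{i+1}$; the concatenation $a=d_1d_2\cdots d_c$ is called a lower central base of $G$. For each $i$, the image of $G_i$ in $\gamma_i(G_X)/\gamma_{i+1}(G_X)$ is isomorphic to $G_i/G_{i+1}$ and is a direct summand: $\gamma_i(G_X)/\gamma_{i+1}(G_X)=G_i/G_{i+1}\times B_i$ for some complement $B_i$. Let $b_i$ be a tuple of elements of $\gamma_i(G_X)$ whose image is a base of $B_i$, where for $i=1$ one takes $B_1$ to be the (free abelian) subgroup generated by the image of $X$ and $b_1=(x_1,\dots,x_k)$. Fix the tuple $e=(b_1d_1)(b_2d_2)\cdots(b_cd_c)$ (concatenation); it is a lower central base of $G_X$ extending $a$. Write $e=(x_1,\dots,x_k,f_1,\dots,f_p)$, where $(f_1,\dots,f_p)=d_1(b_2d_2)\cdots(b_cd_c)$. If $f_s$ belongs to $b_i$ or $d_i$, let $\omega(f_s)\in\mathbb{N}\cup\{\infty\}$ be the order of the image of $f_s$ in $\gamma_i(G_X)/\gamma_{i+1}(G_X)$. Put $\mathbb{Z}_{\omega}=\mathbb{Z}$ if $\omega=\infty$ and $\mathbb{Z}_\omega=\{0,1,\dots,\omega-1\}$ if $\omega$ is finite. **Norm and density.** Every $u\in G_X$ is uniquely written as $u=x_1^{\gamma_1}\cdots x_k^{\gamma_k}f_1^{\delta_1}\cdots f_p^{\delta_p}$ with $\gamma_j\in\mathbb{Z}$,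 $\delta_s\in\mathbb{Z}_{\omega(f_s)}$. The norm is $\|u\|=\max\{|\gamma_1|,\dots,|\gamma_k|,|\delta_1|,\dots,|\delta_p|\}$ and $B_n=\{u\in G_X:\|u\|\le n\}$ (a finite set). For $S\subseteq G_X$, $\rho_n(S)=|S\cap B_n|/|B_n|$. *)

(* Defs.v *)
From HB Require Import structures.
From mathcomp Require Import all_boot all_order all_algebra.
From mathcomp Require Import generic_quotient finmap.
From mathcomp Require Import mathcomp_extra boolp classical_sets functions.
From mathcomp Require Import cardinality reals topology normedtype sequences.

Set Implicit Arguments.
Unset Strict Implicit.
Unset Printing Implicit Defensive.

Import Order.TTheory GRing.Theory Num.Theory numFieldNormedType.Exports.

Local Open Scope classical_set_scope.
Local Open Scope quotient_scope.
Local Open Scope group_scope.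

(** * Subgroups and the lower central series *)

Section Subgroups.
Variable H : groupType.

Definition is_subgroup (A : set H) : Prop :=
  [/\ A 1, (forall x y, A x -> A y -> A (x * y)) & (forall x, A x -> A x^-1)].

Definition subgroup_gen (A : set H) : set H := smallest is_subgroup A.

Record normal_subgroup := NormalSubgroup {
  nsg_set : set H;
  nsg_subgroup : is_subgroup nsg_set;
  nsg_normal : forall x y, nsg_set x -> nsg_set (x ^ y) }.

(* [lcs i] is gamma_i, so that [lcs 1] is the whole group; the index 0, which
   has no meaning, also yields the whole group. *)
Definition lcs (i : nat) : set H :=
  iter i.-1
    (fun A : set H => subgroup_gen [set [~ x, y] | x in A & y in [set: H]])
    [set: H].

Lemma subgroup_genP (A : set H) : is_subgroup (subgroup_gen A).
Proof.
split=> [K [[]]//|x y Ax Ay K KP|x Ax K KP].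
- by case: (KP) => -[_ KM _] _; apply: KM; [apply: Ax|apply: Ay].
- by case: (KP) => -[_ _ KV] _; apply: KV; apply: Ax.
Qed.

Lemma subgroup_gen_normal (A : set H) :
  (forall x y, A x -> A (x ^ y)) ->
  forall x y, subgroup_gen A x -> subgroup_gen A (x ^ y).
Proof.
move=> AJ x y Ax K [[K1 KM KV] AK].
apply: (Ax [set z | K (z ^ y)]); split; first split=> /=.
- by rewrite conj1g.
- by move=> u v Ku Kv; rewrite conjMg; apply: KM.
- by move=> u Ku; rewrite conjVg; apply: KV.
- by move=> z Az; apply/AK/AJ.
Qed.

Lemma lcs_subgroup i : is_subgroup (lcs i).
Proof. by rewrite /lcs; case: i.-1 => [|n] //=; apply: subgroup_genP. Qed.

Lemma lcs_conj i x y : lcs i x -> lcs i (x ^ y).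
Proof.
rewrite /lcs; elim: i.-1 x y => [|n IHn] //= x y.
apply: subgroup_gen_normal => {x y} _ z [x xn [y _ <-]].
by exists (x ^ z); [apply: IHn|exists (y ^ z); rewrite // conjRg].
Qed.

Definition lcsN i : normal_subgroup :=
  NormalSubgroup (@lcs_subgroup i) (@lcs_conj i).

Definition finitely_generated : Prop :=
  exists s : seq H, subgroup_gen [set` s] = [set: H].

Definition nilpotency_class (c : nat) : Prop :=
  lcs c.+1 = [set 1] /\ (forall m, lcs m.+1 = [set 1] -> (c <= m)%N).

End Subgroups.

(** * Quotient groups *)

Section Quotient.
Variables (H : groupType) (N : normal_subgroup H).

Definition coset_rel : rel H := fun x y => `[< nsg_set N (x^-1 * y) >].

Lemma coset_rel_refl : reflexive coset_rel.
Proof. by move=> x; apply/asboolP; rewrite mulVg; case: (nsg_subgroup N). Qed.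

Lemma coset_rel_sym : symmetric coset_rel.
Proof.
have sym x y : coset_rel x y -> coset_rel y x.
  move=> /asboolP Nxy; apply/asboolP; case: (nsg_subgroup N) => _ _ NV.
  by have := NV _ Nxy; rewrite invgM invgK.
by move=> x y; apply/idP/idP; apply: sym.
Qed.

Lemma coset_rel_trans : transitive coset_rel.
Proof.
move=> y x z /asboolP Nxy /asboolP Nyz; apply/asboolP.
case: (nsg_subgroup N) => _ NM _.
by have := NM _ _ Nxy Nyz; rewrite mulgA mulgK.
Qed.

Canonical coset_equiv :=
  EquivRel coset_rel coset_rel_refl coset_rel_sym coset_rel_trans.

Definition quot : Type := {eq_quot coset_equiv}.
HB.instance Definition _ := Choice.on quot.
HB.instance Definition _ := EqQuotient.on quot.

Definition quot_proj (x : H) : quot := \pi_quot x.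

Lemma quot_projP x y : quot_proj x = quot_proj y <-> nsg_set N (x^-1 * y).
Proof.
split=> [/eqquotP/asboolP//|Nxy]; exact/eqquotP/asboolP.
Qed.

Definition quot_one : quot := quot_proj 1.
Definition quot_mul (a b : quot) : quot := quot_proj (repr a * repr b).
Definition quot_inv (a : quot) : quot := quot_proj (repr a)^-1.

Lemma quot_projK a : quot_proj (repr a) = a.
Proof. exact: reprK. Qed.

Lemma quot_projM x y : quot_proj (x * y) = quot_mul (quot_proj x) (quot_proj y).
Proof.
rewrite /quot_mul; set x' := repr _; set y' := repr _.
have /quot_projP Nx : quot_proj x = quot_proj x' by rewrite quot_projK.
have /quot_projP Ny : quot_proj y = quot_proj y' by rewrite quot_projK.
apply/quot_projP; case: (nsg_subgroup N) => _ NM _.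
have := NM _ _ (nsg_normal y Nx) Ny.
by rewrite /conjg invgM !mulgA mulgK.
Qed.

Lemma quot_projV x : quot_proj x^-1 = quot_inv (quot_proj x).
Proof.
rewrite /quot_inv; set x' := repr _.
have /quot_projP Nx : quot_proj x = quot_proj x' by rewrite quot_projK.
apply/quot_projP; case: (nsg_subgroup N) => _ _ NV.
have := nsg_normal x^-1 (NV _ Nx).
by rewrite /conjg invgM !invgK !mulgA mulgK.
Qed.

Lemma quot_mulA : associative quot_mul.
Proof.
move=> a b d; rewrite -(quot_projK a) -(quot_projK b) -(quot_projK d).
by rewrite -!quot_projM mulgA.
Qed.

Lemma quot_mul1 : left_id quot_one quot_mul.
Proof. by move=> a; rewrite -(quot_projK a) -quot_projM mul1g. Qed.

Lemma quot_mulr1 : right_id quot_one quot_mul.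
Proof. by move=> a; rewrite -(quot_projK a) -quot_projM mulg1. Qed.

Lemma quot_mulV : left_inverse quot_one quot_inv quot_mul.
Proof.
by move=> a; rewrite -(quot_projK a) -quot_projV -quot_projM mulVg.
Qed.

Lemma quot_mulrV : right_inverse quot_one quot_inv quot_mul.
Proof.
by move=> a; rewrite -(quot_projK a) -quot_projV -quot_projM mulgV.
Qed.

HB.instance Definition _ := isGroup.Build quot
  quot_mulA quot_mul1 quot_mulr1 quot_mulV quot_mulrV.

HB.instance Definition _ := isMultiplicative.Build H quot quot_proj quot_projM.

End Quotient.

(** * Free groups and free products, as groups of words *)

(* Words over [letter] modulo the monoid congruence generated by [wrel]; the
   two axioms make the quotient monoid a group. *)
Record word_presentation := WordPresentation {
  letter : choiceType;
  linv : letter -> letter;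
  wrel : seq letter -> seq letter -> Prop;
  wrel_linvr : forall t, wrel [:: t; linv t] [::];
  wrel_linvl : forall t, wrel [:: linv t; t] [::] }.

Section WordGroup.
Variable P : word_presentation.
Local Notation word := (seq (letter P)).

Inductive word_cong : word -> word -> Prop :=
| word_cong_step u v w1 w2 : wrel w1 w2 ->
    word_cong (u ++ w1 ++ v) (u ++ w2 ++ v)
| word_cong_refl u : word_cong u u
| word_cong_sym u v : word_cong u v -> word_cong v u
| word_cong_trans u v w : word_cong u v -> word_cong v w -> word_cong u w.

Definition word_rel : rel word := fun u v => `[< word_cong u v >].

Lemma word_rel_refl : reflexive word_rel.
Proof. by move=> u; apply/asboolP; constructor. Qed.

Lemma word_rel_sym : symmetric word_rel.
Proof.
by move=> u v; apply/asboolP/asboolP => ?; apply: word_cong_sym.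
Qed.

Lemma word_rel_trans : transitive word_rel.
Proof.
move=> v u w /asboolP uv /asboolP vw; apply/asboolP.
exact: word_cong_trans vw.
Qed.

Canonical word_equiv :=
  EquivRel word_rel word_rel_refl word_rel_sym word_rel_trans.

Definition word_group : Type := {eq_quot word_equiv}.
HB.instance Definition _ := Choice.on word_group.
HB.instance Definition _ := EqQuotient.on word_group.

Definition word_class (u : word) : word_group := \pi_word_group u.

Lemma word_classP u v : word_class u = word_class v <-> word_cong u v.
Proof. by split=> [/eqquotP/asboolP//|uv]; apply/eqquotP/asboolP. Qed.

Definition word_inv (u : word) : word := rev (map (@linv P) u).

Definition wg_one : word_group := word_class [::].
Definition wg_mul (a b : word_group) : word_group :=
  word_class (repr a ++ repr b).
Definition wg_inv (a : word_group) : word_group := word_class (word_inv (repr a)).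

Lemma word_cong_cat u u' v v' :
  word_cong u u' -> word_cong v v' -> word_cong (u ++ v) (u' ++ v').
Proof.
move=> uu' vv'; apply: (@word_cong_trans _ (u' ++ v)).
  elim: uu' => [s t w1 w2 r|s|s t _|s t w _ st _ tw].
  - by rewrite -!catA; apply: word_cong_step.
  - exact: word_cong_refl.
  - exact: word_cong_sym.
  - exact: word_cong_trans tw.
elim: vv' => [s t w1 w2 r|s|s t _|s t w _ st _ tw].
- by rewrite !(catA u'); apply: word_cong_step.
- exact: word_cong_refl.
- exact: word_cong_sym.
- exact: word_cong_trans tw.
Qed.

Lemma word_invr u : word_cong (u ++ word_inv u) [::].
Proof.
elim: u => [|t u IHu]; first exact: word_cong_refl.
rewrite /word_inv /= rev_cons -cats1 -/(word_inv u) catA -cat1s.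
apply: (@word_cong_trans _ ([:: t] ++ [::] ++ [:: linv t])).
  apply: word_cong_cat; first exact: word_cong_refl.
  by apply: word_cong_cat => //; apply: word_cong_refl.
by have := word_cong_step [::] [::] (wrel_linvr t).
Qed.

Lemma word_invl u : word_cong (word_inv u ++ u) [::].
Proof.
elim: u => [|t u IHu]; first exact: word_cong_refl.
rewrite /word_inv /= rev_cons -cats1 -/(word_inv u) -catA /=.
have := word_cong_step (word_inv u) u (wrel_linvl t).
by move=> /word_cong_trans; apply.
Qed.

Lemma word_classK a : word_class (repr a) = a.
Proof. exact: reprK. Qed.

Lemma word_classM u v :
  word_class (u ++ v) = wg_mul (word_class u) (word_class v).
Proof.
by apply/word_classP; apply: word_cong_cat; apply/word_classP;
   rewrite word_classK.
Qed.

Lemma wg_mulA : associative wg_mul.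
Proof.
move=> a b d; rewrite -(word_classK a) -(word_classK b) -(word_classK d).
by rewrite -!word_classM catA.
Qed.

Lemma wg_mul1 : left_id wg_one wg_mul.
Proof. by move=> a; rewrite -(word_classK a) -word_classM. Qed.

Lemma wg_mulr1 : right_id wg_one wg_mul.
Proof. by move=> a; rewrite -(word_classK a) -word_classM cats0. Qed.

Lemma wg_mulV : left_inverse wg_one wg_inv wg_mul.
Proof.
move=> a; rewrite /wg_inv -{2}(word_classK a) -word_classM.
exact/word_classP/word_invl.
Qed.

Lemma wg_mulrV : right_inverse wg_one wg_inv wg_mul.
Proof.
move=> a; rewrite /wg_inv -{1}(word_classK a) -word_classM.
exact/word_classP/word_invr.
Qed.

HB.instance Definition _ := isGroup.Build word_group
  wg_mulA wg_mul1 wg_mulr1 wg_mulV wg_mulrV.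

End WordGroup.

Section FreeGroup.
Variable X : choiceType.

(* The letter (x, true) stands for x and (x, false) for its inverse. *)
Definition free_linv (t : X * bool) : X * bool := (t.1, ~~ t.2).

Inductive free_wrel : seq (X * bool) -> seq (X * bool) -> Prop :=
| Free_cancel t : free_wrel [:: t; free_linv t] [::].

Lemma free_wrel_linvl t : free_wrel [:: free_linv t; t] [::].
Proof.
have {2}-> : t = free_linv (free_linv t) by case: t => x [].
exact: Free_cancel.
Qed.

Definition free_presentation : word_presentation :=
  WordPresentation Free_cancel free_wrel_linvl.

Definition free_group : groupType := word_group free_presentation.

Definition free_gen (x : X) : free_group :=
  word_class (P := free_presentation) [:: (x, true)].

End FreeGroup.

Section FreeProduct.
Variables G H : groupType.

Definition fprod_linv (t : G + H) : G + H :=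
  match t with inl g => inl g^-1 | inr h => inr h^-1 end.

Inductive fprod_wrel : seq (G + H) -> seq (G + H) -> Prop :=
| Fprod_mull g g' : fprod_wrel [:: inl g; inl g'] [:: inl (g * g')]
| Fprod_mulr h h' : fprod_wrel [:: inr h; inr h'] [:: inr (h * h')]
| Fprod_onel : fprod_wrel [:: inl 1] [::]
| Fprod_oner : fprod_wrel [:: inr 1] [::]
| Fprod_invr t : fprod_wrel [:: t; fprod_linv t] [::]
| Fprod_invl t : fprod_wrel [:: fprod_linv t; t] [::].

Definition fprod_presentation : word_presentation :=
  WordPresentation Fprod_invr Fprod_invl.

Definition free_product : groupType := word_group fprod_presentation.

Definition fprod_inl (g : G) : free_product :=
  word_class (P := fprod_presentation) [:: inl g].
Definition fprod_inr (h : H) : free_product :=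
  word_class (P := fprod_presentation) [:: inr h].

Lemma fprod_inlM g g' : fprod_inl (g * g') = fprod_inl g * fprod_inl g'.
Proof.
apply/esym; rewrite [LHS](esym (word_classM _ _)); apply/word_classP.
exact: (word_cong_step (P := fprod_presentation) [::] [::] (Fprod_mull g g')).
Qed.

Lemma fprod_inrM h h' : fprod_inr (h * h') = fprod_inr h * fprod_inr h'.
Proof.
apply/esym; rewrite [LHS](esym (word_classM _ _)); apply/word_classP.
exact: (word_cong_step (P := fprod_presentation) [::] [::] (Fprod_mulr h h')).
Qed.

HB.instance Definition _ :=
  isMultiplicative.Build G free_product fprod_inl fprod_inlM.
HB.instance Definition _ :=
  isMultiplicative.Build H free_product fprod_inr fprod_inrM.

End FreeProduct.

(** * The space of equations *)

Section Equations.
Variables (G : groupType) (c k : nat).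

(* N_c(X) with X = {x_1, ..., x_k} *)
Definition free_nilpotent : groupType := quot (lcsN (free_group 'I_k) c.+1).

(* G_X *)
Definition equations : groupType :=
  quot (lcsN (free_product G free_nilpotent) c.+1).

Definition coef (g : G) : equations := quot_proj _ (fprod_inl _ g).

Definition var (j : 'I_k) : equations :=
  quot_proj _ (fprod_inr _ (quot_proj _ (free_gen j))).

Definition SAT : set equations :=
  [set u | exists (h : 'I_k -> G) (phi : {multiplicative equations -> G}),
     [/\ forall g, phi (coef g) = g, forall j, phi (var j) = h j & phi u = 1]].

End Equations.
Arguments SAT : clear implicits.

(** * Bases *)

Section Bases.
Variable H : groupType.

Definition zexpg (x : H) (z : int) : H :=
  match z with Posz n => x ^+ n | Negz n => x ^- n.+1 end.

(* Internal direct product of a list of subgroups. *)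
Definition direct_product (C : set H) (As : seq (set H)) : Prop :=
  let A := tnth (in_tuple As) in
  [/\ forall i, is_subgroup (A i),
      forall i j, i != j -> forall x y, A i x -> A j y -> commute x y,
      forall y : {ffun 'I_(size As) -> H},
        (forall i, A i (y i)) -> C (\prod_i y i) &
      forall u, C u -> exists! y : {ffun 'I_(size As) -> H},
        (forall i, A i (y i)) /\ u = \prod_i y i].

(* The order of an element, [None] standing for infinity. *)
Definition elt_order (x : H) : option nat :=
  match pselect (exists n, (0 < n)%N && (x ^+ n == 1)) with
  | left h => Some (ex_minn h)
  | right _ => None
  end.

(* [C] is commutative as soon as it satisfies this. *)
Definition is_base (C : set H) (s : seq H) : Prop :=
  direct_product C [seq subgroup_gen [set x] | x <- s] /\
  exists s1 s2, [/\ s = s1 ++ s2, forall x, x \in s1 -> elt_order x = None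
                                & forall x, x \in s2 -> elt_order x <> None].

End Bases.

Section LowerCentralBase.
Variables (G : groupType) (c k : nat).
Local Notation GX := (equations G c k).

Definition vars : seq GX := [seq var G c j | j <- enum 'I_k].

(* The factor gamma_i / gamma_{i+1} of a group H is the image of gamma_i in
   H / gamma_{i+1}; the complement B_i is a subset of G_X / gamma_{i+1}(G_X). *)
Definition lower_central_base_data (d : nat -> seq G)
    (B : forall i, set (quot (lcsN GX i.+1))) (b : nat -> seq GX) : Prop :=
  [/\ forall i, (1 <= i <= c)%N ->
        (forall x, x \in d i -> lcs i x) /\
        is_base (quot_proj (lcsN G i.+1) @` lcs i)
                [seq quot_proj (lcsN G i.+1) x | x <- d i],
      forall i, (1 <= i <= c)%N ->
        direct_product (quot_proj (lcsN GX i.+1) @` lcs i)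
          [:: [set quot_proj (lcsN GX i.+1) (coef c k g) | g in lcs i]; B i],
      forall i, (1 <= i <= c)%N ->
        (forall x, x \in b i -> lcs i x) /\
        is_base (B i) [seq quot_proj (lcsN GX i.+1) x | x <- b i],
      B 1%N = subgroup_gen (quot_proj (lcsN GX 2) @` [set` vars]) &
      b 1%N = vars].

(* The tuple e = (x_1, ..., x_k, f_1, ..., f_p), each member paired with the
   bound omega on its exponents ([None] for infinity). *)
Definition lc_base (d : nat -> seq G) (b : nat -> seq GX) :
    seq (GX * option nat) :=
  [seq (x, None) | x <- vars] ++
  flatten [seq [seq (f, elt_order (quot_proj (lcsN GX i.+1) f))
                 | f <- (if i == 1%N then [::] else b i) ++
                        [seq coef c k g | g <- d i]]
            | i <- iota 1 c].

End LowerCentralBase.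

(** * Norm and density *)

Section Norm.
Variables (H : groupType) (e : seq (H * option nat)).

(* z belongs to Z_omega *)
Definition in_Zomega (w : option nat) (z : int) : Prop :=
  match w with None => True | Some m => (0 <= z < m%:Z)%R end.

Definition is_coordinates (u : H) (z : {ffun 'I_(size e) -> int}) : Prop :=
  (forall i, in_Zomega (tnth (in_tuple e) i).2 (z i)) /\
  u = \prod_i zexpg (tnth (in_tuple e) i).1 (z i).

(* When [e] is a lower central base the coordinates exist and are unique; the
   default value is irrelevant. *)
Definition coordinates (u : H) : {ffun 'I_(size e) -> int} :=
  xget [ffun=> 0%R] (is_coordinates u).

Definition norm (u : H) : nat := \max_i `|coordinates u i|%N.

Definition nball (n : nat) : set H := [set u | (norm u <= n)%N].

(* [fset_set A] is [A] as a finite set when [A] is finite, which balls are. *)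
Definition density (R : realType) (S : set H) (n : nat) : R :=
  ((#|` fset_set (S `&` nball n)|%fset)%:R /
   (#|` fset_set (nball n)|%fset)%:R)%R.

End Norm.

(* Main.v *)
(* In the abelianization of G, which is infinite because G is, choose a member
   t of d_1 of infinite order. If u = x^z_0 * ... is satisfied by x = h, then
   comparing exponents of t in the abelianization gives z_0 a + z_t = 0, where
   a is the exponent of t in h: so z_0 divides the exponent z_t of coef t in u.
   Uniqueness of coordinates makes z_0 and z_t range freely over [-n, n] in the
   ball B_n, and only o(n^2) pairs (z_0, z_t) there satisfy z_0 | z_t. *)

Require Import Defs.
From HB Require Import structures.
From mathcomp Require Import all_boot all_order all_algebra.
From mathcomp Require Import finmap.
From mathcomp Require Import boolp classical_sets cardinality reals topology
  normedtype sequences.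
From mathcomp Require Import zify.

Set Implicit Arguments.
Unset Strict Implicit.
Unset Printing Implicit Defensive.

Import Order.TTheory GRing.Theory Num.Theory numFieldNormedType.Exports.

Local Open Scope classical_set_scope.
Local Open Scope ring_scope.

(** * Subgroups, morphisms and the lower central series *)

(** The data provide bases of abelian factors only, while the norm needs unique coordinates in all
    of [equations]; [coord_system], a notion relative to two subgroups, climbs from one to the
    other. The bounds on exponents are orders computed in [equations]; they are compared with orders
    in [G] by evaluating the variables, at 1 to retract onto the coefficients, at [t] to see that
    variables have infinite order modulo [lcs 2]. The size of a ball is never computed: exchanging
    two coordinates with free parameters bounds the frequency directly, whatever torsion constrains
    the other coordinates. A fixed cutoff [m] on the divisors, chosen from the tolerance, replaces
    an asymptotic count of divisors. *)

Lemma subgroup_gen_incl (H : groupType) (A : set H) : A `<=` subgroup_gen A.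
Proof. exact: sub_gen_smallest. Qed.

Lemma subgroup_gen_min (H : groupType) (A K : set H) :
  is_subgroup K -> A `<=` K -> subgroup_gen A `<=` K.
Proof. exact: smallest_sub. Qed.

Lemma subgroup_zexpg (H : groupType) (K : set H) (x : H) (n : int) :
  is_subgroup K -> K x -> K (zexpg x n).
Proof.
move=> [K1 KM KV] Kx.
have KX m : K (x ^+ m)%g.
  by elim: m => [//|m IHm]; rewrite expgS; apply: KM.
by case: n => m /=; [|apply: KV].
Qed.

Lemma subgroup_preimage (H K : groupType) (f : UMagmaMorphism.type H K)
  (A : set K) : is_subgroup A -> is_subgroup (f @^-1` A).
Proof.
move=> [A1 AM AV]; split=> /= [|x y Ax Ay|x Ax].
- by rewrite gmulf1.
- by rewrite gmulfM; apply: AM.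
- by rewrite gmulfV; apply: AV.
Qed.

Lemma subgroup_image (H K : groupType) (f : UMagmaMorphism.type H K)
  (A : set H) : is_subgroup A -> is_subgroup (f @` A).
Proof.
move=> [A1 AM AV]; split=> [|_ _ [x Ax <-] [y Ay <-]|_ [x Ax <-]].
- by exists 1%g; rewrite ?gmulf1.
- by exists (x * y)%g; rewrite ?gmulfM //; apply: AM.
- by exists (x^-1)%g; rewrite ?gmulfV //; apply: AV.
Qed.

Lemma lcs1 (H : groupType) : @lcs H 1 = [set: H]. Proof. by []. Qed.

Lemma lcsSS (H : groupType) (i : nat) : @lcs H i.+2 =
  subgroup_gen [set [~ x, y]%g | x in @lcs H i.+1 & y in [set: H]].
Proof. by []. Qed.

Lemma lcs_comm (H : groupType) (i : nat) (x y : H) :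
  @lcs H i.+1 x -> @lcs H i.+2 [~ x, y]%g.
Proof.
by move=> ix; rewrite lcsSS; apply: subgroup_gen_incl; exists x => //; exists y.
Qed.

Lemma lcsS_sub (H : groupType) (i : nat) : @lcs H i.+1 `<=` @lcs H i.
Proof.
case: i => [//|i]; rewrite lcsSS; apply: subgroup_gen_min.
  exact: lcs_subgroup.
move=> _ [x ix [y _ <-]]; rewrite commgEl.
have [_ iM iV] := lcs_subgroup H i.+1.
by apply: iM; [apply: iV|apply: lcs_conj].
Qed.

Lemma lcs_sub (H : groupType) (i j : nat) :
  (i <= j)%N -> @lcs H j `<=` @lcs H i.
Proof.
move=> ij; rewrite -(subnK ij); elim: (_ - _)%N => [//|n IHn].
by rewrite addSn => x /lcsS_sub /IHn.
Qed.

Lemma lcs_morph (H K : groupType) (f : UMagmaMorphism.type H K) (i : nat)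
  (x : H) : @lcs H i x -> @lcs K i (f x).
Proof.
case: i => [//|i]; elim: i x => [//|i IHi] x; rewrite lcsSS.
apply: (@subgroup_gen_min _ _ (f @^-1` @lcs K i.+2)).
  by apply: subgroup_preimage; apply: lcs_subgroup.
move=> _ [y iy [z _ <-]] /=; rewrite gmulfR.
by apply: lcs_comm; apply: IHi.
Qed.

Lemma lcs_surj (H K : groupType) (f : UMagmaMorphism.type H K) (i : nat) :
  (forall y, exists x, f x = y) -> @lcs K i `<=` f @` @lcs H i.
Proof.
move=> f_surj; have base : @lcs K 1 `<=` f @` @lcs H 1.
  by move=> y _; have [x <-] := f_surj y; exists x.
case: i => [//|i]; elim: i => [//|i IHi]; rewrite lcsSS.
apply: subgroup_gen_min; first by apply: subgroup_image; apply: lcs_subgroup.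
move=> _ [_ /IHi[x ix <-] [y _ <-]]; have [z <-] := f_surj y.
by exists [~ x, z]%g; [apply: lcs_comm|rewrite gmulfR].
Qed.

(** * Quotients and the universal property of the group of equations *)

HB.instance Definition _ (H : groupType) (N : normal_subgroup H) :=
  Multiplicative_isUMagmaMorphism.Build H (quot N) (quot_proj N)
    (erefl (quot_one N)).

Lemma quot_proj_surj (H : groupType) (N : normal_subgroup H) (a : quot N) :
  exists x, quot_proj N x = a.
Proof. by exists (repr a); rewrite quot_projK. Qed.

Lemma quot_proj_eq1 (H : groupType) (N : normal_subgroup H) (x : H) :
  quot_proj N x = 1%g <-> nsg_set N x.
Proof.
rewrite (_ : 1%g = quot_proj N 1%g) //.
split=> [/esym/quot_projP|Nx]; first by rewrite invg1 mul1g.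
by apply/esym/quot_projP; rewrite invg1 mul1g.
Qed.

(** Taken at [c.+1] for the free product, it says that [equations] has class at most [c], which
    closes the last level of coordinates. *)
Lemma lcs_quot_lcs (H : groupType) (c : nat) :
  @lcs (quot (lcsN H c)) c = [set 1%g].
Proof.
apply/seteqP; split=> [y|_ ->].
  2: by have [] := lcs_subgroup (quot (lcsN H c)) c.
move=> /(@lcs_surj _ _ (quot_proj (lcsN H c)) c (@quot_proj_surj _ _)).
by move=> [x cx <-]; apply/quot_proj_eq1.
Qed.

Lemma morph_group (H K : groupType) (f : H -> K) :
  {morph f : x y / x * y}%g -> exists phi : UMagmaMorphism.type H K, phi =1 f.
Proof.
move=> fM; have f1 : f 1%g = 1%g by apply: (mulgI (f 1%g)); rewrite -fM !mulg1.
by exists (HB.pack_for (UMagmaMorphism.type H K) f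
  (isUMagmaMorphism.Build H K f (f1, fM))).
Qed.

Lemma quot_lift (H K : groupType) (N : normal_subgroup H)
  (f : UMagmaMorphism.type H K) : (forall x, nsg_set N x -> f x = 1%g) ->
  exists phi : UMagmaMorphism.type (quot N) K,
    forall x, phi (quot_proj N x) = f x.
Proof.
move=> fN; have fE x y : quot_proj N x = quot_proj N y -> f x = f y.
  by move/quot_projP/fN; rewrite gmulfM gmulfV => /mulg1_eq; rewrite invgK.
have [|phi phiE] := @morph_group (quot N) K (fun a => f (repr a)).
  move=> a b; rewrite -gmulfM; apply: fE.
  by rewrite quot_projM !quot_projK.
by exists phi => x; rewrite phiE; apply: fE; rewrite quot_projK.
Qed.

Lemma word_lift (P : word_presentation) (K : groupType) (f : letter P -> K) :
  (forall u v, wrel u v -> \prod_(t <- u) f t = \prod_(t <- v) f t)%g ->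
  exists phi : UMagmaMorphism.type (word_group P) K,
    forall u, phi (word_class u) = (\prod_(t <- u) f t)%g.
Proof.
move=> fR; have fE u v : word_class u = word_class v ->
    (\prod_(t <- u) f t = \prod_(t <- v) f t)%g.
  move/word_classP.
  elim=> {u v} [s t u v /fR uv|//|u v _ ->//|u v w _ -> _ ->//].
  by rewrite !big_cat /= uv.
have [|phi phiE] := @morph_group (word_group P) K
    (fun a => \prod_(t <- repr a) f t)%g.
  move=> a b; rewrite -big_cat /=; apply: fE.
  by rewrite word_classM !word_classK.
by exists phi => u; rewrite phiE; apply: fE; rewrite word_classK.
Qed.

Lemma free_group_lift (X : choiceType) (K : groupType) (f : X -> K) :
  exists phi : UMagmaMorphism.type (free_group X) K,
    forall x, phi (free_gen x) = f x.
Proof.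
have [|phi phiE] := @word_lift (free_presentation X) K
    (fun t => if t.2 then f t.1 else (f t.1)^-1)%g.
  move=> _ _ [[x []]]; rewrite !big_cons !big_nil /= mulg1.
    exact: mulgV.
  exact: mulVg.
by exists phi => x; rewrite phiE big_seq1.
Qed.

Lemma free_product_lift (G H K : groupType) (f : UMagmaMorphism.type G K)
  (g : UMagmaMorphism.type H K) :
  exists phi : UMagmaMorphism.type (free_product G H) K,
    (forall x, phi (fprod_inl _ x) = f x) /\
    (forall y, phi (fprod_inr _ y) = g y).
Proof.
have [|phi phiE] := @word_lift (fprod_presentation G H) K
    (fun t => match t with inl x => f x | inr y => g y end).
  by move=> _ _ [x x'|y y'|||[x|y]|[x|y]]; rewrite !big_cons !big_nil ?mulg1
    -?gmulfM ?mulgV ?mulVg ?gmulf1.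
by exists phi; split=> x; rewrite phiE big_seq1.
Qed.

Lemma coef_divg (G : groupType) (c k : nat) :
  {morph @coef G c k : x y / x / y}%g.
Proof.
move=> x y; have coefM a b : coef c k (a * b)%g = (coef c k a * coef c k b)%g.
  by rewrite /coef !gmulfM.
by rewrite -[x in RHS](mulgVK y x) [in RHS]coefM mulgK.
Qed.

HB.instance Definition _ (G : groupType) (c k : nat) :=
  isGroupMorphism.Build G (equations G c k) (@coef G c k) (@coef_divg G c k).

(** Since [lcs c.+1] is trivial in [G], the morphisms given by freeness factor through both
    quotients by [lcs c.+1]. *)
Lemma equations_lift (G : groupType) (c k : nat) (h : 'I_k -> G) :
  @lcs G c.+1 = [set 1%g] ->
  exists phi : UMagmaMorphism.type (equations G c k) G,
    (forall g, phi (coef c k g) = g) /\ (forall j, phi (var G c j) = h j).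
Proof.
move=> nilG; have [f fE] := free_group_lift h.
have [x /(lcs_morph f)|g gE] := @quot_lift _ _ (lcsN (free_group 'I_k) c.+1) f.
  by rewrite nilG.
have [p [pl pr]] := free_product_lift (idfun : UMagmaMorphism.type G G) g.
have [x /(lcs_morph p)|phi phiE] := @quot_lift _ _ (lcsN _ c.+1) p.
  by rewrite nilG.
exists phi; split=> [a|j]; first by rewrite phiE pl.
by rewrite phiE pr gE.
Qed.

(** * Integer powers and orders *)

(** Every integer is a difference of naturals, so this reduces the law of exponents to natural
    powers, without cases on signs. *)
Lemma zexpg_sub (H : groupType) (x : H) (m n : nat) :
  zexpg x (m%:Z - n%:Z) = (x ^+ m / x ^+ n)%g.
Proof.
case: (leqP n m) => [nm|mn].
  by rewrite -(subnK nm) PoszD addrK expgnDr mulgK.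
have -> : m%:Z - n%:Z = Negz (n - m).-1 by rewrite NegzE; lia.
by rewrite /= prednK ?subn_gt0 // -{2}(subnK (ltnW mn)) expgnDr invgM mulVKg.
Qed.

Lemma int_natB (z : int) : exists m n : nat, z = m%:Z - n%:Z.
Proof. by case: z => n; [exists n, 0%N|exists 0%N, n.+1]; lia. Qed.

Lemma zexpgD (H : groupType) (x : H) (a b : int) :
  zexpg x (a + b) = (zexpg x a * zexpg x b)%g.
Proof.
have [m [n ->]] := int_natB a; have [p [q ->]] := int_natB b.
have -> : m%:Z - n%:Z + (p%:Z - q%:Z) = (m + p)%N%:Z - (q + n)%N%:Z by lia.
rewrite !zexpg_sub !expgnDr invgM -!mulgA; congr (_ * _)%g.
rewrite !mulgA; congr (_ * _)%g.
exact/commuteV/commuteX2/commute_refl.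
Qed.

Lemma zexpgN (H : groupType) (x : H) (a : int) :
  zexpg x (- a) = (zexpg x a)^-1%g.
Proof. by apply/esym/mulg1_eq; rewrite -zexpgD subrr. Qed.

Lemma zexpgM (H : groupType) (x : H) (a b : int) :
  zexpg (zexpg x a) b = zexpg x (a * b).
Proof.
have zexpgMn n : (zexpg x a ^+ n)%g = zexpg x (a * n%:Z).
  elim: n => [|n IHn]; first by rewrite mulr0.
  by rewrite expgS IHn -zexpgD -addn1 PoszD mulrDr mulr1 addrC.
by case: b => n; rewrite /= zexpgMn // -zexpgN NegzE mulrN.
Qed.

Lemma zexpg1 (H : groupType) (a : int) : zexpg 1%g a = 1%g :> H.
Proof. by case: a => n; rewrite /= expg1n ?invg1. Qed.

Lemma gmulf_zexpg (H K : groupType) (f : UMagmaMorphism.type H K) (x : H)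
  (a : int) : f (zexpg x a) = zexpg (f x) a.
Proof. by case: a => n; rewrite /= ?gmulfV gmulfXn. Qed.

(** The exponents that kill [x] form an ideal of the integers: the zero ideal, or the one generated
    by the order. *)
Lemma elt_orderP (H : groupType) (x : H) :
  match elt_order x with
  | None => forall z, zexpg x z = 1%g -> z = 0
  | Some m => (0 < m)%N /\ forall z, zexpg x z = 1%g <-> (m %| z)%Z
  end.
Proof.
rewrite /elt_order; case: pselect => [x_fin|x_inf].
  case: ex_minnP => m /andP[m0 /eqP xm] m_min; split=> // z.
  have xz : zexpg x z = zexpg x (z %% m)%Z.
    rewrite {1}(divz_eq z m) mulrC zexpgD -zexpgM /=.
    by rewrite xm zexpg1 mul1g.
  rewrite xz; split=> [xz1|/dvdz_mod0P ->//]; apply/dvdz_mod0P; move: xz1.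
  have: (0 <= z %% m)%Z by rewrite modz_ge0 //; lia.
  have: (z %% m < m)%Z by rewrite ltz_pmod //; lia.
  case: (z %% m)%Z => // [[|k]] //= km _ /eqP xk.
  by have := m_min k.+1; rewrite xk => /(_ isT); lia.
have xn n : (x ^+ n.+1)%g <> 1%g.
  by move=> xn; apply: x_inf; exists n.+1; rewrite xn eqxx.
case=> [[|n]|n] //= => [/xn//|]; move/eqP; rewrite invg_eq1 => /eqP.
by move/xn.
Qed.

Lemma cyclic_exponent (H : groupType) (x y : H) : subgroup_gen [set x] y ->
  exists n, y = zexpg x n.
Proof.
apply: (subgroup_gen_min (K := [set y | exists n, y = zexpg x n])).
  split=> [|_ _ [m ->] [n ->]|_ [n ->]]; first by exists 0.
  - by exists (m + n); rewrite zexpgD.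
  - by exists (- n); rewrite zexpgN.
by move=> _ ->; exists 1.
Qed.

Lemma cyclic_coordinate (H : groupType) (x y : H) : subgroup_gen [set x] y ->
  exists! n, in_Zomega (elt_order x) n /\ y = zexpg x n.
Proof.
move=> /cyclic_exponent[n ->]; have := elt_orderP x.
have zexpg_eq a b : zexpg x a = zexpg x b -> zexpg x (a - b) = 1%g.
  by move=> ab; rewrite zexpgD zexpgN ab mulgV.
case: (elt_order x) => [m [m0 xm]|x_inf] /=; last first.
  exists n; split=> // k [_ /esym/zexpg_eq/x_inf/eqP].
  by rewrite subr_eq0 => /eqP.
have m0' : m%:Z != 0 by lia.
exists (n %% m)%Z; split.
  split; first by rewrite modz_ge0 //= ltz_pmod.
  rewrite [in LHS](divz_eq n m) mulrC zexpgD -zexpgM.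
  by rewrite (xm m%:Z).2 // zexpg1 mul1g.
move=> k [/andP[k0 km] /zexpg_eq/xm]; rewrite -eqz_mod_dvd => /eqP ->.
by rewrite modz_small // k0.
Qed.

Lemma eq_elt_order (H K : groupType) (x : H) (y : K) :
  (forall n, x ^+ n = 1 <-> y ^+ n = 1)%g -> elt_order x = elt_order y.
Proof.
(* Abstracting the order as a function of the predicate lets an equality of predicates transfer it,
   although [ex_minn] carries a proof. *)
move=> xy; pose order (P : pred nat) := match pselect (exists n, P n) with
  | left h => Some (ex_minn h) | right _ => None end.
rewrite -[LHS]/(order (fun n => (0 < n)%N && (x ^+ n == 1)%g)).
rewrite -[RHS]/(order (fun n => (0 < n)%N && (y ^+ n == 1)%g)).
congr order; apply/funext => n; congr andb.
by apply/eqP/eqP => /xy.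
Qed.

(** * Coordinate systems between two subgroups *)

(** Exponent vectors are sequences here because concatenating bases concatenates them;
    [is_coordinatesE] translates to the finite functions of [coordinates]. *)
Fixpoint admissible (H : Type) (e : seq (H * option nat)) (z : seq int) :
    Prop :=
  match e, z with
  | [::], [::] => True
  | p :: e', a :: z' => in_Zomega p.2 a /\ admissible e' z'
  | _, _ => False
  end.

Fixpoint eprod (H : groupType) (e : seq (H * option nat)) (z : seq int) : H :=
  match e, z with
  | p :: e', a :: z' => (zexpg p.1 a * eprod e' z')%g
  | _, _ => 1%g
  end.

Lemma admissible_size (H : Type) (e : seq (H * option nat)) (z : seq int) :
  admissible e z -> size z = size e.
Proof. by elim: e z => [|p e IHe] [|a z] //= [_ /IHe ->]. Qed.

Lemma admissible_nth (H : Type) (p0 : H * option nat) (e : seq (H * option nat))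
    (z : seq int) :
  admissible e z <-> size z = size e /\
    forall i, (i < size e)%N -> in_Zomega (nth p0 e i).2 (nth 0 z i).
Proof.
elim: e z => [|p e IHe] [|a z] /=; split=> // -[].
- by [].
- by [].
- move=> pa /IHe[-> ez]; split=> // -[|i] //=; exact: ez.
- move=> [zE] ez; split; first exact: (ez 0%N).
  by apply/IHe; split=> // i ie; apply: (ez i.+1).
Qed.

Lemma admissible_cat (H : Type) (e1 e2 : seq (H * option nat))
    (z1 z2 : seq int) :
  admissible e1 z1 -> admissible e2 z2 -> admissible (e1 ++ e2) (z1 ++ z2).
Proof.
by elim: e1 z1 => [|p e IHe] [|a z] //= [pa ez] ez2; split=> //; apply: IHe.
Qed.

Lemma admissible_catP (H : Type) (e1 e2 : seq (H * option nat)) (z : seq int) :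
  admissible (e1 ++ e2) z ->
  exists z1 z2, [/\ z = z1 ++ z2, admissible e1 z1 & admissible e2 z2].
Proof.
elim: e1 z => [|p e IHe] z /=; first by exists [::], z.
case: z => [//|a z] [pa /IHe[z1 [z2 [-> ez1 ez2]]]].
by exists (a :: z1), z2.
Qed.

Lemma eprod_cat (H : groupType) (e1 e2 : seq (H * option nat))
    (z1 z2 : seq int) : admissible e1 z1 ->
  eprod (e1 ++ e2) (z1 ++ z2) = (eprod e1 z1 * eprod e2 z2)%g.
Proof.
elim: e1 z1 => [|p e IHe] [|a z] //=; rewrite ?mul1g //.
by move=> [_ /IHe ->]; rewrite mulgA.
Qed.

Lemma eprod_nth (H : groupType) (p0 : H * option nat)
    (e : seq (H * option nat)) (z : seq int) : size z = size e ->
  eprod e z = (\prod_(i < size e) zexpg (nth p0 e i).1 (nth 0 z i))%g.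
Proof.
elim: e z => [|p e IHe] [|a z] //=; first by rewrite big_ord0.
by move=> [zE]; rewrite big_ord_recl /= IHe.
Qed.

Lemma eprod_subgroup (H : groupType) (K : set H) (e : seq (H * option nat))
    (z : seq int) :
  is_subgroup K -> (forall p, p \in e -> K p.1) -> K (eprod e z).
Proof.
move=> Ksub; have [K1 KM _] := Ksub.
elim: e z => [|p e IHe] [|a z] //= Ke; apply: KM.
  by apply: subgroup_zexpg => //; apply: Ke; rewrite mem_head.
by apply: IHe => q qe; apply: Ke; rewrite in_cons qe orbT.
Qed.

Lemma gmulf_eprod (H K : groupType) (f : UMagmaMorphism.type H K)
    (e : seq (H * option nat)) (z : seq int) :
  f (eprod e z) = eprod [seq (f p.1, p.2) | p <- e] z.
Proof.
elim: e z => [|p e IHe] [|a z] /=; rewrite ?gmulf1 //.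
by rewrite gmulfM gmulf_zexpg IHe.
Qed.

Lemma admissible_map (H K : Type) (f : H -> K) (e : seq (H * option nat))
    (z : seq int) :
  admissible [seq (f p.1, p.2) | p <- e] z = admissible e z.
Proof. by elim: e z => [|p e IHe] [|a z] //=; rewrite IHe. Qed.

(** For a subgroup [N], each left coset of [N] meeting [K] contains the product of exactly one
    admissible vector. Trivial [N] gives coordinates proper. *)
Definition coord_system (H : groupType) (K N : set H)
    (e : seq (H * option nat)) : Prop :=
  forall u, K u -> exists! z, admissible e z /\ N ((eprod e z)^-1 * u)%g.

(** The vector along [e1] fixes the coset modulo [N], and the remainder in [N] is expanded along
    [e2]. Products along [e2] stay in [N], so they cannot disturb the first vector, whence
    uniqueness. *)
Lemma coord_system_cat (H : groupType) (K N M : set H)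
    (e1 e2 : seq (H * option nat)) :
  is_subgroup N -> M `<=` N -> (forall p, p \in e2 -> N p.1) ->
  coord_system K N e1 -> coord_system N M e2 -> coord_system K M (e1 ++ e2).
Proof.
move=> Nsub MN Ne2 sys1 sys2 u Ku.
have [z1 [[adm1 Nz1] uniq1]] := sys1 u Ku.
have [z2 [[adm2 Mz2] uniq2]] := sys2 _ Nz1.
exists (z1 ++ z2); split.
  split; first exact: admissible_cat.
  by rewrite eprod_cat // invgM -mulgA.
move=> z [/admissible_catP[y1 [y2 [-> adm1' adm2']]]].
rewrite eprod_cat // invgM -mulgA => My.
have y1E : z1 = y1.
  apply: uniq1; split=> //; have [_ NM _] := Nsub.
  rewrite -(mulVKg (eprod e2 y2) (_ * u)%g).
  exact: NM (eprod_subgroup y2 Nsub Ne2) (MN _ My).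
by rewrite -y1E in My *; rewrite (uniq2 y2).
Qed.

(** As [N1] is the preimage of [N2], a vector suits [u] exactly when it suits [f u]. This carries
    bases of factors back to the groups themselves. *)
Lemma coord_system_morph (H1 H2 : groupType) (f : UMagmaMorphism.type H1 H2)
    (K N1 : set H1) (N2 : set H2) (e : seq (H1 * option nat)) :
  (forall x, N2 (f x) <-> N1 x) ->
  coord_system (f @` K) N2 [seq (f p.1, p.2) | p <- e] <-> coord_system K N1 e.
Proof.
move=> fN.
have fE u z : N2 ((eprod [seq (f p.1, p.2) | p <- e] z)^-1 * f u)%g <->
    N1 ((eprod e z)^-1 * u)%g.
  by rewrite -gmulf_eprod -gmulfV -gmulfM; apply: fN.
split=> [sys u Ku|sys _ [u Ku <-]].
  have [|z [[adm Nz] uniq]] := sys (f u); first by exists u.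
  exists z; split; first by rewrite -(admissible_map f); split=> //; apply/fE.
  move=> z' [adm' Nz']; apply: uniq; rewrite admissible_map.
  by split=> //; apply/fE.
have [z [[adm Nz] uniq]] := sys u Ku.
exists z; split; first by rewrite admissible_map; split=> //; apply/fE.
move=> z' [adm' Nz']; apply: uniq; rewrite -(admissible_map f).
by split=> //; apply/fE.
Qed.

Lemma direct_product2 (H : groupType) (C A B : set H) :
  direct_product C [:: A; B] ->
  [/\ is_subgroup A, is_subgroup B, forall x y, A x -> B y -> commute x y &
   forall u, C u -> exists x y, [/\ A x, B y, u = (x * y)%g &
     forall x' y', A x' -> B y' -> u = (x' * y')%g -> x = x' /\ y = y']].
Proof.
move=> [/= sub comm _ decomp].
have cases (P : 'I_2 -> Prop) : P ord0 -> P (@Ordinal 2 1 isT) -> forall i, P i.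
  move=> P0 P1 [[|[|//]] i2].
    by rewrite (_ : Ordinal _ = ord0) //; apply: val_inj.
  by rewrite (_ : Ordinal _ = @Ordinal 2 1 isT) //; apply: val_inj.
have Asub := sub ord0; have Bsub := sub (@Ordinal 2 1 isT).
split=> //; first by move=> x y; apply: (comm ord0 (@Ordinal 2 1 isT)).
move=> u /decomp[y [[yAB uE] uniq]].
exists (y ord0), (y (@Ordinal 2 1 isT)); split.
- exact: yAB ord0.
- exact: yAB (@Ordinal 2 1 isT).
- rewrite uE !big_ord_recl big_ord0 mulg1; do 3?congr (_ * _)%g.
  by congr (y _); apply: val_inj.
- move=> a b Aa Bb uab.
  have yE : y = [ffun i : 'I_2 => if i == 0 :> nat then a else b].
    apply: uniq; split; first by apply: cases; rewrite ffunE.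
    by rewrite uab !big_ord_recl big_ord0 mulg1 !ffunE.
  by rewrite yE !ffunE.
Qed.

(** Coordinates along [eB] are read modulo [A], which commutes with [B]. The order [eB ++ eA] is the
    one in which [b i] precedes [d i] in the base. *)
Lemma coord_system_direct (H : groupType) (C A B : set H)
    (eA eB : seq (H * option nat)) :
  direct_product C [:: A; B] ->
  (forall p, p \in eA -> A p.1) -> (forall p, p \in eB -> B p.1) ->
  coord_system A [set 1%g] eA -> coord_system B [set 1%g] eB ->
  coord_system C [set 1%g] (eB ++ eA).
Proof.
move=> /direct_product2[Asub Bsub comm decomp] AeA BeB sysA sysB.
apply: (coord_system_cat (N := A)) => //; first by move=> _ ->; case: Asub.
move=> u /decomp[x [y [Ax By -> uniq]]].
have [z [[adm /= /mulg1_eq]]] := sysB y By; rewrite invgK => yE uniqB.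
exists z; split; first by rewrite yE comm // mulKg.
move=> z' [adm' Az']; apply: uniqB; split=> //=.
have Bz' : B (eprod eB z') by exact: eprod_subgroup.
have [|_ <-] := uniq _ _ Az' Bz'; last by rewrite mulVg.
by rewrite (comm _ _ Az' Bz') mulVKg.
Qed.

Lemma coord_system_base (H : groupType) (C : set H) (s : seq H) :
  is_base C s -> coord_system C [set 1%g] [seq (x, elt_order x) | x <- s].
Proof.
set e := map _ _; pose p0 := (1%g : H, elt_order (1%g : H)).
case=> -[/=]; set As := map _ s => sub _ _ decomp _.
have eE i : nth p0 e i = (nth 1%g s i, elt_order (nth 1%g s i)).
  by rewrite /e; elim: (s) i => [|x t IHt] [|i] //=.
have sizeA : size As = size e by rewrite !size_map.
have AsE (i : 'I_(size As)) :
    tnth (in_tuple As) i = subgroup_gen [set nth 1%g s i].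
  rewrite (tnth_nth [set 1%g]) /= (nth_map 1%g) //.
  by rewrite -(size_map (fun x => subgroup_gen [set x])).
have prodE z : size z = size e -> eprod e z =
    (\prod_(i < size As) [ffun j : 'I_(size As) =>
       zexpg (nth 1%g s j) (nth 0 z j)] i)%g.
  move=> zs; rewrite (eprod_nth p0) // -sizeA.
  by apply: eq_bigr => i _; rewrite eE ffunE.
move=> u /decomp[y [[yA uE] uniq]].
(* Exponents are chosen for all naturals, to be tabulated by [mkseq]; the value 0 past the end is
   never read. *)
have /choice[f fP] (k : nat) : exists n,
    forall i : 'I_(size As), i = k :> nat ->
    in_Zomega (elt_order (nth 1%g s k)) n /\ y i = zexpg (nth 1%g s k) n.
  case: (ltnP k (size As)) => [kA|Ak]; last first.
    by exists 0 => i ik; have := ltn_ord i; rewrite ik ltnNge Ak.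
  have := yA (Ordinal kA); rewrite AsE /= => /cyclic_coordinate[n [nP _]].
  by exists n => i ik; rewrite (_ : i = Ordinal kA) //; apply: val_inj.
exists (mkseq f (size e)); split.
  split.
    apply/(admissible_nth p0); rewrite size_mkseq; split=> // i ie.
    rewrite nth_mkseq // eE /=; rewrite -sizeA in ie.
    by have [] := fP i (Ordinal ie).
  rewrite prodE ?size_mkseq // (_ : (\prod_i _)%g = u) ?mulVg //= uE.
  apply: eq_bigr => i _; rewrite ffunE nth_mkseq -?sizeA //.
  by rewrite (fP i i erefl).2.
move=> z [adm /= /mulg1_eq]; rewrite invgK => zE.
have [zs zZ] := (admissible_nth p0 e z).1 adm.
have yE : y = [ffun j : 'I_(size As) => zexpg (nth 1%g s j) (nth 0 z j)].
  apply: uniq; split; last by rewrite -prodE.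
  move=> i; rewrite AsE ffunE.
  exact: (subgroup_zexpg _ (@subgroup_genP _ _)
    (@subgroup_gen_incl _ [set nth 1%g s i] _ erefl)).
apply: (@eq_from_nth _ 0) => [|i]; rewrite size_mkseq ?zs // => ie.
rewrite nth_mkseq //; have iA : (i < size As)%N by rewrite sizeA.
have := yA (Ordinal iA); rewrite AsE => /cyclic_coordinate[n [_ n_uniq]].
rewrite -(n_uniq (f i)); last exact: fP i (Ordinal iA) erefl.
apply: n_uniq; split; last by rewrite yE ffunE.
by have := zZ i ie; rewrite eE.
Qed.

Lemma is_base_mem (H : groupType) (C : set H) (s : seq H) (x : H) :
  is_base C s -> x \in s -> C x.
Proof.
case=> -[/=]; set As := map _ s => sub _ prodC _ _ xs.
have iA : (index x s < size As)%N by rewrite size_map index_mem.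
pose i := Ordinal iA.
have <- : (\prod_j [ffun j : 'I_(size As) => if j == i then x else 1] j)%g = x.
  by rewrite (big_only1 i) ?ffunE ?eqxx // => j /negPf ji; rewrite ffunE ji.
apply: prodC => j; rewrite ffunE; case: eqP => [->|_]; last by case: (sub j).
rewrite (tnth_nth [set 1%g]) /= (nth_map x) ?index_mem // nth_index //.
exact: subgroup_gen_incl.
Qed.

Lemma coord_system_level (H : groupType) (i : nat) (s : seq H) :
  is_base (quot_proj (lcsN H i.+1) @` lcs i)
    [seq quot_proj (lcsN H i.+1) x | x <- s] ->
  coord_system (lcs i) (lcs i.+1)
    [seq (x, elt_order (quot_proj (lcsN H i.+1) x)) | x <- s].
Proof.
move=> /coord_system_base; rewrite -map_comp => sys.
apply/(@coord_system_morph _ _ (quot_proj (lcsN H i.+1)) _ _ [set 1%g]).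
  by move=> x; apply: quot_proj_eq1.
by rewrite -map_comp.
Qed.

(** The evaluation of all variables at 1 is a left inverse of [coef], and morphisms respect
    [lcs]. *)
Lemma lcs_coef (G : groupType) (c k i : nat) (g : G) :
  @lcs G c.+1 = [set 1%g] -> lcs i (coef c k g) <-> lcs i g.
Proof.
move=> nilG; split=> [|gi]; last exact: lcs_morph.
have [phi [phiC _]] := @equations_lift G c k (fun=> 1%g) nilG.
by move=> /(lcs_morph phi); rewrite phiC.
Qed.

Lemma coord_system_equations (G : groupType) (c k i : nat) (d : seq G)
    (b : seq (equations G c k))
    (B : set (quot (lcsN (equations G c k) i.+1))) :
  @lcs G c.+1 = [set 1%g] ->
  (forall x, x \in d -> lcs i x) ->
  is_base (quot_proj (lcsN G i.+1) @` lcs i)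
    [seq quot_proj (lcsN G i.+1) x | x <- d] ->
  direct_product (quot_proj (lcsN (equations G c k) i.+1) @` lcs i)
    [:: [set quot_proj (lcsN (equations G c k) i.+1) (coef c k g) | g in lcs i];
        B] ->
  is_base B [seq quot_proj (lcsN (equations G c k) i.+1) x | x <- b] ->
  coord_system (lcs i) (lcs i.+1)
    [seq (f, elt_order (quot_proj (lcsN (equations G c k) i.+1) f))
      | f <- b ++ [seq coef c k g | g <- d]].
Proof.
move=> nilG id d_base AB b_base.
pose q := quot_proj (lcsN (equations G c k) i.+1).
pose qc : UMagmaMorphism.type _ _ := q \o coef c k.
(* The kernel being exactly [lcs i.+1], the base [d] of the factor of [G] becomes, with the same
   orders, a base of its image in the factor of [equations]. *)
have qcP g : qc g = 1%g <-> lcs i.+1 g.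
  rewrite -(@lcs_coef G c k) //; exact: quot_proj_eq1.
apply/(@coord_system_morph _ _ q _ _ [set 1%g]).
  by move=> x; apply: quot_proj_eq1.
rewrite !map_cat; apply: (coord_system_direct AB).
- by move=> _ /mapP[_ /mapP[_ /mapP[g /id gd ->] ->] ->]; exists g.
- move=> _ /mapP[_ /mapP[x xb ->] ->]; apply: is_base_mem b_base _.
  exact: map_f.
- have /coord_system_level := d_base.
  move=> /(@coord_system_morph _ _ qc _ _ [set 1%g]) sysd.
  have := sysd qcP; rewrite -!map_comp; congr coord_system.
  apply: eq_map => g /=; congr pair; apply: eq_elt_order => n.
  by rewrite -(gmulfXn qc) qcP -gmulfXn quot_proj_eq1.
- by have := coord_system_base b_base; rewrite -!map_comp.
Qed.

(** * Finitely many torsion factors give a finite group *)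

(** Modulo [lcs i.+2] the elements of [lcs i.+1] commute, so there the [m]-th power is a morphism;
    this is its kernel. *)
Lemma power_subgroup (G : groupType) (m i : nat) :
  is_subgroup [set x : G | lcs i.+1 x /\ lcs i.+2 (x ^+ m)%g].
Proof.
have [S1 SM SV] := @lcs_subgroup G i.+1.
have [T1 TM TV] := @lcs_subgroup G i.+2.
split=> [|x y [ix mx] [iy my]|x [ix mx]] /=; first by rewrite expg1n.
  split; first exact: SM.
  apply/(quot_proj_eq1 (lcsN G i.+2)); rewrite gmulfXn gmulfM expgMn.
    by rewrite -!gmulfXn /= !(quot_proj_eq1 (lcsN G i.+2) _).2 ?mulg1.
  apply/commgP; rewrite -gmulfR; apply/eqP/quot_proj_eq1.
  exact: lcs_comm.
by rewrite expVgn; split; [apply: SV|apply: TV].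
Qed.

(* [x, y]^m is congruent to [x^m, y], since [x, y] is central modulo the next
   term. *)
Lemma lcs_power (G : groupType) (m i : nat) (x : G) :
  (forall x : G, lcs 2 (x ^+ m)%g) -> lcs i.+1 x -> lcs i.+2 (x ^+ m)%g.
Proof.
move=> m2; elim: i x => [//|i IHi] x; rewrite lcsSS => ix.
suff [] : [set x : G | lcs i.+2 x /\ lcs i.+3 (x ^+ m)%g] x by [].
move: x ix; apply: subgroup_gen_min; first exact: power_subgroup.
move=> _ [x ix [y _ <-]] /=; split; first exact: lcs_comm.
pose q : UMagmaMorphism.type _ _ := quot_proj (lcsN G i.+3).
have qxy : commute (q x) [~ q x, q y]%g.
  have -> : [~ q x, q y]%g = q [~ x, y]%g by rewrite gmulfR.
  have : q [~ [~ x, y], x]%g = 1%g.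
    by apply/quot_proj_eq1; apply: (lcs_comm x (lcs_comm y ix)).
  by rewrite gmulfR => /eqP/commgP/commute_sym.
have : q [~ x ^+ m, y]%g = 1%g.
  by apply/quot_proj_eq1; apply: lcs_comm _ (IHi _ ix).
(* [[x^m, y]] is [x^-m * (x^y)^m], and [x^y = x * [x, y]] has commuting factors in the quotient, so
   [[x, y]^m] remains. *)
rewrite gmulfR commgEl gmulfXn conjXg.
have -> : (q x ^ q y = q x * [~ q x, q y])%g by rewrite commgEl mulVKg.
by rewrite expgMn // mulKg -gmulfR -gmulfXn => /quot_proj_eq1.
Qed.

Lemma finite_eprod (H : groupType) (e : seq (H * option nat)) :
  (forall p, p \in e -> p.2 <> None) ->
  finite_set [set eprod e z | z in admissible e].
Proof.
elim: e => [|p e IHe] pe.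
  by apply: sub_finite_set (finite_set1 1%g) => _ [[|//] _ <-].
have /IHe fe : forall r, r \in e -> r.2 <> None.
  by move=> r re; apply: pe; rewrite in_cons re orbT.
case: p {pe} (pe p (mem_head _ _)) => x [m|//] _.
apply: sub_finite_set (finite_image2 (fun x y => x * y)%g
  (finite_image (fun n => (x ^+ n)%g) (finite_II m)) fe).
move=> _ [[//|[n|n] z] [/= nm ez] <-] //; exists (x ^+ n)%g; first by exists n.
by exists (eprod e z) => //; exists z.
Qed.

Lemma common_exponent (H : groupType) (s : seq H) :
  (forall x, x \in s -> elt_order x <> None) ->
  exists2 m, (0 < m)%N & forall x, x \in s -> (x ^+ m)%g = 1%g.
Proof.
elim: s => [|x s IHs] sP; first by exists 1%N.
have [|m m0 ms] := IHs.
  by move=> y ys; apply: sP; rewrite in_cons ys orbT.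
have := elt_orderP x; case: elt_order (sP x (mem_head _ _)) => [n _|//].
case=> n0 /(_ n%:Z)[_ /(_ (dvdzz n)) /= xn]; exists (n * m)%N.
  by rewrite muln_gt0 n0.
move=> y; rewrite in_cons => /predU1P[->|ys]; first by rewrite expgnA xn expg1n.
by rewrite mulnC expgnA ms // expg1n.
Qed.

(** If all of [d 1] had finite order, a common exponent [m] would kill the abelianization, hence by
    [lcs_power] every factor. Each factor, spanned by finitely many torsion elements, would be
    finite, and so would [G]. *)
Lemma infinite_order_generator (G : groupType) (c : nat) (d : nat -> seq G) :
  infinite_set [set: G] -> @lcs G c.+1 = [set 1%g] ->
  (forall i, (1 <= i <= c)%N -> (forall x, x \in d i -> lcs i x) /\
     is_base (quot_proj (lcsN G i.+1) @` lcs i)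
             [seq quot_proj (lcsN G i.+1) x | x <- d i]) ->
  (0 < c)%N /\
  exists2 t, t \in d 1%N & elt_order (quot_proj (lcsN G 2) t) = None.
Proof.
move=> infG nilG d_base.
have c0 : (0 < c)%N.
  by case: c nilG {d_base} => // nilG; case: infG; rewrite -lcs1 nilG.
split=> //; apply: contra_notP infG => t_fin.
have [x /mapP[t td ->] tN|m m0 md] :=
    @common_exponent _ [seq quot_proj (lcsN G 2) x | x <- d 1%N].
  by apply: t_fin; exists t.
have m2 (x : G) : lcs 2 (x ^+ m)%g.
  have [_ /coord_system_level/(_ x I)[z [[_ xz] _]]] := d_base 1%N c0.
  (* The subgroup of elements whose [m]-th power lies in [lcs 2] contains [d 1] and [lcs 2], hence
     every [x]. *)
  have Psub := @power_subgroup G m 0%N; have [_ PM _] := Psub.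
  rewrite -(mulVKg (eprod [seq (x, elt_order (quot_proj (lcsN G 2) x))
    | x <- d 1%N] z) x).
  apply: (PM _ _ _ _).2.
    apply: eprod_subgroup => // _ /mapP[t td ->]; split=> //=.
    by apply/(quot_proj_eq1 (lcsN G 2)); rewrite gmulfXn md // map_f.
  split=> //; have [T1 TM _] := @lcs_subgroup G 2.
  by elim: (m) => [//|n IHn]; rewrite expgS; apply: TM.
(* Induction from the trivial term upward: a term is covered by the products of finitely many
   [eprod] values with the next term. *)
suff fin n : (n <= c)%N -> finite_set (@lcs G (c.+1 - n)).
  by have := fin c (leqnn c); rewrite subSnn.
elim: n => [_|n IHn nc]; first by rewrite subn0 nilG; apply: finite_set1.
rewrite subSS; have := IHn (ltnW nc); rewrite subSn ?(ltnW nc) // => fin.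
have ci : (0 < c - n)%N by rewrite subn_gt0.
have [] := d_base (c - n)%N; first by rewrite ci leq_subr.
move=> di /coord_system_level sys.
set e := map _ _ in sys.
have /(@finite_eprod _ e) fe : forall p, p \in e -> p.2 <> None.
  move=> _ /mapP[x xd ->] /= x_inf; have := elt_orderP (quot_proj
    (lcsN G (c - n).+1) x); rewrite x_inf => /(_ m%:Z) /= => x0.
  have: m%:Z = 0; last by lia.
  apply: x0; rewrite -gmulfXn; apply/quot_proj_eq1.
  rewrite /= -(prednK ci); apply: lcs_power => //.
  by rewrite (prednK ci); apply: di.
apply: sub_finite_set (finite_image2 (fun x y => x * y)%g fe fin) => u.
move=> /sys[z [[ez uz] _]].
exists (eprod e z); first by exists z.
by exists ((eprod e z)^-1 * u)%g => //; rewrite mulVKg.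
Qed.

(** * Coordinates with respect to a lower central base *)

(** Evaluating every variable at [t] turns a finite order of the variable into one of [t]. This
    reconciles the bound [None] that [lc_base] assigns to variables with their actual order. *)
Lemma elt_order_var (G : groupType) (c k : nat) (j : 'I_k) (t : G) :
  @lcs G c.+1 = [set 1%g] -> elt_order (quot_proj (lcsN G 2) t) = None ->
  elt_order (quot_proj (lcsN (equations G c k) 2) (var G c j)) = None.
Proof.
move=> nilG t_inf; set x := quot_proj _ _.
have := elt_orderP x; case: (elt_order x) => [m [m0 xm]|//].
have [phi [_ phix]] := @equations_lift G c k (fun=> t) nilG.
have := elt_orderP (quot_proj (lcsN G 2) t); rewrite t_inf => /(_ m%:Z) /= tm.
suff : m%:Z = 0 by lia.
apply: tm; rewrite -gmulfXn; apply/quot_proj_eq1.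
rewrite /= -(phix j) -gmulfXn; apply: lcs_morph.
apply: (quot_proj_eq1 (lcsN (equations G c k) 2) _).1.
rewrite gmulfXn; exact: ((xm m%:Z).2 (dvdzz _)).
Qed.

Definition lc_level (G : groupType) (c k : nat) (d : nat -> seq G)
    (b : nat -> seq (equations G c k)) (i : nat) :
    seq (equations G c k * option nat) :=
  [seq (f, elt_order (quot_proj (lcsN (equations G c k) i.+1) f))
    | f <- (if i == 1%N then [::] else b i) ++ [seq coef c k g | g <- d i]].

Lemma lc_baseE (G : groupType) (c k : nat) (d : nat -> seq G)
    (b : nat -> seq (equations G c k)) : (0 < c)%N ->
  lc_base d b = [seq (x, None) | x <- vars G c k] ++ lc_level d b 1 ++
    flatten [seq lc_level d b i | i <- iota 2 c.-1].
Proof. by case: c d b. Qed.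

Section LowerCentralBase.
Variables (G : groupType) (c k : nat) (d : nat -> seq G).
Variables (B : forall i, set (quot (lcsN (equations G c k) i.+1))).
Variable b : nat -> seq (equations G c k).
Hypothesis base : lower_central_base_data d B b.

Lemma lc_level_lcs (i : nat) (p : equations G c k * option nat) :
  (1 <= i <= c)%N -> p \in lc_level d b i -> lcs i p.1.
Proof.
move=> ic; have [dP _ bP _ _] := base.
have [di _] := dP i ic; have [bi _] := bP i ic.
move=> /mapP[f + ->] /=; rewrite mem_cat => /orP[|/mapP[g /di gi ->]].
  by case: ifP => // _ /bi.
exact: lcs_morph.
Qed.

Lemma lc_levels_lcs (i m : nat) (p : equations G c k * option nat) :
  (0 < i)%N -> (i + m <= c.+1)%N ->
  p \in flatten [seq lc_level d b j | j <- iota i m] -> lcs i p.1.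
Proof.
move=> i0 imc /flattenP[_ /mapP[j + ->]]; rewrite mem_iota => /andP[ij jm].
move=> /lc_level_lcs jp; apply: (lcs_sub ij); apply: jp.
by rewrite (leq_trans i0 ij) -ltnS (leq_trans jm imc).
Qed.

Hypothesis nilG : @lcs G c.+1 = [set 1%g].

(** Level 1 is left out because [lc_level] lacks the variables there: they stand at the head of
    [lc_base]. *)
Lemma coord_system_levels (i m : nat) : (1 < i)%N -> (i + m <= c.+1)%N ->
  coord_system (lcs i) (lcs (i + m))
    (flatten [seq lc_level d b j | j <- iota i m]).
Proof.
elim: m i => [|m IHm] i i1 imc.
  rewrite addn0 => u iu; exists [::]; split; first by rewrite /= invg1 mul1g.
  by case=> [//|a z] [].
have [dP AB bP _ _] := base.
have ic : (1 <= i <= c)%N by lia.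
have [di d_base] := dP i ic; have [bi b_base] := bP i ic.
rewrite /= addnS -addSn; apply: (coord_system_cat (N := @lcs _ i.+1)).
- exact: lcs_subgroup.
- by apply: lcs_sub; rewrite leq_addr.
- by move=> p; apply: lc_levels_lcs => //; rewrite addSnnS.
- rewrite /lc_level gtn_eqF //; exact: coord_system_equations (AB i ic) _.
- by apply: IHm; [apply: ltnW|rewrite addSnnS].
Qed.

Lemma coord_system_lc_base (t : G) : (0 < c)%N ->
  elt_order (quot_proj (lcsN G 2) t) = None ->
  coord_system [set: equations G c k] [set 1%g] (lc_base d b).
Proof.
move=> c0 t_inf; have [dP AB bP _ b1E] := base.
have [d1 d_base] := dP 1%N c0; have [_ b_base] := bP 1%N c0.
rewrite lc_baseE // catA; apply: (coord_system_cat (N := @lcs _ 2)).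
- exact: lcs_subgroup.
- by move=> _ ->; have [] := @lcs_subgroup (equations G c k) 2.
- by move=> p; apply: lc_levels_lcs => //; rewrite add2n prednK.
- have := coord_system_equations nilG d1 d_base (AB 1%N c0) b_base.
  rewrite map_cat b1E; congr (coord_system _ _ (_ ++ _)).
  apply/eq_in_map => _ /mapP[j _ ->].
  by rewrite (elt_order_var _ nilG t_inf).
have := @coord_system_levels 2 c.-1 isT; rewrite add2n prednK //.
rewrite (_ : @lcs (equations G c k) c.+1 = [set 1%g]); first exact.
exact: lcs_quot_lcs.
Qed.

End LowerCentralBase.

Lemma is_coordinatesE (H : groupType) (e : seq (H * option nat)) (u : H)
    (z : {ffun 'I_(size e) -> int}) :
  is_coordinates u z <-> admissible e (fgraph z) /\ u = eprod e (fgraph z).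
Proof.
pose p0 := (1%g : H, @None nat).
have zs : size (fgraph z) = size e by rewrite size_tuple card_ord.
rewrite (eprod_nth p0) // (_ : (\prod_(i < size e) zexpg (nth p0 e i).1 _)%g =
    (\prod_i zexpg (tnth (in_tuple e) i).1 (z i))%g); last first.
  by apply: eq_bigr => i _; rewrite nth_fgraph_ord (tnth_nth p0).
split=> -[adm ->]; split=> //.
  apply/(admissible_nth p0); split=> // i ie.
  by have := adm (Ordinal ie); rewrite (tnth_nth p0) -(nth_fgraph_ord 0).
move=> i; have [_ /(_ i (ltn_ord i))] := (admissible_nth p0 _ _).1 adm.
by rewrite (tnth_nth p0) -[z i](nth_fgraph_ord 0).
Qed.

Lemma coord_system_coordinates (H : groupType) (e : seq (H * option nat)) :
  coord_system [set: H] [set 1%g] e ->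
  forall u, exists! z : {ffun 'I_(size e) -> int}, is_coordinates u z.
Proof.
move=> sys u; have [z [[adm zu] uniq]] := sys u I.
have graphK (z' : seq int) : size z' = size e ->
    fgraph [ffun i : 'I_(size e) => nth 0 z' i] = z' :> seq int.
  move=> zs; apply: (@eq_from_nth _ 0) => [|i].
    by rewrite size_tuple card_ord.
  rewrite [X in (_ < X)%N]size_tuple [X in (_ < X)%N]card_ord => ie.
  by rewrite (nth_fgraph_ord 0 (Ordinal ie)) ffunE.
have zE := graphK z (admissible_size adm).
exists [ffun i : 'I_(size e) => nth 0 z i]; split.
  apply/is_coordinatesE; rewrite zE; split=> //.
  by move: zu => /= /mulg1_eq; rewrite invgK.
move=> z' /is_coordinatesE[adm' uE].
have /uniq zz' : admissible e (fgraph z') /\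
    [set 1%g] ((eprod e (fgraph z'))^-1 * u)%g by split; rewrite //= uE mulVg.
by apply/ffunP => i; rewrite ffunE zz' nth_fgraph_ord.
Qed.

(** * Divisibility imposed by satisfiability *)

(** Unique decomposition makes the [i]-th component a function; by commutativity the componentwise
    product of two decompositions decomposes the product, so this function is a morphism. *)
Lemma direct_product_projection (H : groupType) (As : seq (set H))
    (i : 'I_(size As)) :
  (forall x y : H, commute x y) -> direct_product [set: H] As ->
  exists pi : UMagmaMorphism.type H H,
    [/\ forall x, tnth (in_tuple As) i (pi x),
        forall x, tnth (in_tuple As) i x -> pi x = x &
        forall j x, j != i -> tnth (in_tuple As) j x -> pi x = 1%g].
Proof.
set A := tnth (in_tuple As) => commH [sub _ _ decomp].
have /choice[y yP] u : exists y : {ffun 'I_(size As) -> H},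
    (forall j, A j (y j)) /\ u = (\prod_j y j)%g.
  by have [y [yP _]] := decomp u I; exists y.
have yE u y' : (forall j, A j (y' j)) -> u = (\prod_j y' j)%g ->
    y u = [ffun j => y' j].
  move=> Ay' uE; have [z [_ uniq]] := decomp u I.
  rewrite -(uniq _ (yP u)); apply: uniq; split=> [j|].
    by rewrite ffunE; apply: Ay'.
  by rewrite uE; apply: eq_bigr => j _; rewrite ffunE.
have [|pi piE] := @morph_group H H (fun u => y u i).
  move=> u v; rewrite (@yE _ (fun j => y u j * y v j)%g) ?ffunE //.
    by move=> j; have [_ AM _] := sub j; exact: AM ((yP u).1 j) ((yP v).1 j).
  by rewrite prodgM_commute // -(yP u).2 -(yP v).2.
have y_delta j x : A j x -> y x = [ffun l => if l == j then x else 1%g].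
  move=> Ax; apply: yE => [l|].
    by case: (eqVneq l j) => [->//|_]; case: (sub l).
  by rewrite (big_only1 j) ?eqxx // => l /negPf ->.
exists pi; split=> [x|x Ax|j x ji Ax]; rewrite piE.
- exact: (yP x).1.
- by rewrite (y_delta i) // ffunE eqxx.
- by rewrite (y_delta j) // ffunE eq_sym (negPf ji).
Qed.

Lemma abelianization_comm (G : groupType) (x y : quot (lcsN G 2)) : commute x y.
Proof.
have [a <-] := quot_proj_surj x; have [a' <-] := quot_proj_surj y.
apply/commgP; rewrite -(gmulfR (quot_proj (lcsN G 2))); apply/eqP/quot_proj_eq1.
exact: (@lcs_comm G 0).
Qed.

(* Killing all the factors of [G / lcs 2] but the one of [t], a solution [h] of
   the equation satisfies [h ^ z_0 * t ^ z_(j.+1) = 1] in an infinite cyclic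
   group. *)
Lemma SAT_dvd (G : groupType) (c : nat) (d : nat -> seq G)
    (B : forall i, set (quot (lcsN (equations G c 1) i.+1)))
    (b : nat -> seq (equations G c 1)) (t : G) (z : seq int) :
  (0 < c)%N -> lower_central_base_data d B b ->
  t \in d 1%N -> elt_order (quot_proj (lcsN G 2) t) = None ->
  admissible (lc_base d b) z -> SAT G c 1 (eprod (lc_base d b) z) ->
  (nth 0 z 0 %| nth 0 z (index t (d 1%N)).+1)%Z.
Proof.
move=> c0 base td t_inf; have [dP _ _ _ _] := base.
have [_ [d_base _]] := dP 1%N c0.
rewrite lc_baseE // /vars enum_ordSl enum_ord0 /=.
case: z => [//|z0 z] /= [_ /admissible_catP[z1 [z2 [-> adm1 adm2]]]].
rewrite eprod_cat // => -[h [phi0 [phi_coef _]]].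
have [phi phiE] := @morph_group _ _ phi0 gmulfM.
rewrite -phiE => phi_u.
have {}phi_coef g : phi (coef c 1 g) = g by rewrite phiE.
set q := quot_proj (lcsN G 2) in t_inf d_base.
set As := map _ _ in d_base.
have sizeA : size As = size (d 1%N) by rewrite !size_map.
have jA : (index t (d 1%N) < size As)%N by rewrite sizeA index_mem.
have AsN l : (l < size (d 1%N))%N ->
    nth [set 1%g] As l = subgroup_gen [set q (nth 1%g (d 1%N) l)].
  by move=> ld; rewrite /As -map_comp (nth_map 1%g).
have AsE (l : 'I_(size As)) :
    tnth (in_tuple As) l = subgroup_gen [set q (nth 1%g (d 1%N) l)].
  by rewrite (tnth_nth [set 1%g]) /= AsN // -sizeA.
have [|pi [pi_t piK pi1]] :=
  @direct_product_projection _ As (Ordinal jA) (@abelianization_comm G).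
  rewrite (_ : [set: _] = q @` @lcs G 1) //.
  by apply/seteqP; split=> // y _; have [x <-] := quot_proj_surj y; exists x.
(* Substitution of the solution, then abelianization, then projection to the infinite cyclic factor
   of [t]. *)
pose psi : UMagmaMorphism.type _ _ := pi \o (q \o phi).
have psi_t : psi (coef c 1 t) = q t.
  rewrite /= phi_coef; apply: piK; rewrite AsE /= nth_index //.
  exact: subgroup_gen_incl.
have psi1 : psi (eprod (lc_level d b 1) z1) =
    zexpg (q t) (nth 0 z1 (index t (d 1%N))).
  rewrite gmulf_eprod (eprod_nth (1%g, None)); last first.
    by rewrite size_map (admissible_size adm1).
  have sizeE : size [seq (psi p.1, p.2) | p <- lc_level d b 1] = size As.
    by rewrite sizeA !size_map.
  have jE : (index t (d 1%N) <
      size [seq (psi p.1, p.2) | p <- lc_level d b 1])%N by rewrite sizeE.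
  have nthE l : (l < size As)%N -> (nth (1%g, None)
      [seq (psi p.1, p.2) | p <- lc_level d b 1] l).1 =
      psi (coef c 1 (nth 1%g (d 1%N) l)).
    rewrite sizeA => ld.
    rewrite (nth_map (1%g, None)) ?size_map //= (nth_map 1%g) ?size_map //=.
    by rewrite (nth_map 1%g).
  rewrite (big_only1 (Ordinal jE)) //= => [|l lj _].
    by rewrite nthE // nth_index // psi_t.
  have lA : (l < size As)%N by rewrite -sizeE.
  rewrite nthE // (_ : psi _ = 1%g) ?zexpg1 //= phi_coef.
  apply: (pi1 (Ordinal lA)).
    by move: lj; apply: contra => /eqP/(congr1 val)/= lj; apply/eqP/val_inj.
  by rewrite AsE /=; apply: subgroup_gen_incl.
(* Levels from 2 on lie in [lcs 2], which the abelianization kills. *)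
have psi2 :
    psi (eprod (flatten [seq lc_level d b i | i <- iota 2 c.-1]) z2) = 1%g.
  rewrite -[psi _]/(pi (q (phi _))) (_ : q _ = 1%g) ?gmulf1 //.
  apply/quot_proj_eq1.
  apply: lcs_morph; apply: eprod_subgroup; first exact: lcs_subgroup.
  by move=> p; apply: (lc_levels_lcs base) => //; rewrite add2n prednK.
have [a psi_x] : exists a, psi (var G c ord0) = zexpg (q t) a.
  apply: cyclic_exponent; have := pi_t (q (phi (var G c ord0))).
  by rewrite AsE /= nth_index.
have : psi (zexpg (var G c ord0) z0 * (eprod (lc_level d b 1) z1 *
    eprod (flatten [seq lc_level d b i | i <- iota 2 c.-1]) z2))%g = 1%g.
  by rewrite /= phi_u !gmulf1.
rewrite !gmulfM psi1 psi2 mulg1 gmulf_zexpg psi_x zexpgM -zexpgD.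
have := elt_orderP (q t); rewrite t_inf => inf /inf /eqP.
rewrite addrC addr_eq0 nth_cat (admissible_size adm1) !size_map index_mem td.
by move=> /eqP ->; rewrite -mulNr dvdz_mull.
Qed.

(** * Density *)

Definition zball (n : nat) : seq int :=
  [seq k%:Z - n%:Z | k <- iota 0 (n.*2.+1)].

Lemma size_zball (n : nat) : size (zball n) = n.*2.+1.
Proof. by rewrite size_map size_iota. Qed.

Lemma zball_uniq (n : nat) : uniq (zball n).
Proof. by rewrite map_inj_uniq ?iota_uniq // => x y /addIr[]. Qed.

Lemma mem_zball (n : nat) (a : int) : (a \in zball n) = (`|a| <= n)%N.
Proof.
apply/mapP/idP => [[k + ->]|an]; first by rewrite mem_iota; lia.
by exists `|(a + n%:Z)%R|%N; rewrite ?mem_iota; lia.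
Qed.

(* Divisors are split at [m]: a divisor larger than [m] has at most
   [2 * (n / m) + 1] multiples of absolute value at most [n]. *)
Definition dvd_pairs (m n : nat) : seq (int * int) :=
  [seq (a, b) | a <- zball m, b <- zball n] ++
  [seq (a, a * q) | a <- zball n, q <- zball (n %/ m)].

Lemma size_dvd_pairs (m n : nat) :
  size (dvd_pairs m n) = (n.*2.+1 * (m.*2.+1 + (n %/ m).*2.+1))%N.
Proof. by rewrite size_cat !size_allpairs !size_zball; lia. Qed.

Lemma mem_dvd_pairs (m n : nat) (a b : int) : (0 < m)%N -> (a %| b)%Z ->
  (`|a| <= n)%N -> (`|b| <= n)%N -> (a, b) \in dvd_pairs m n.
Proof.
move=> m0 /dvdzP[q ->] an bn; rewrite mem_cat; apply/orP.
case: (leqP `|a| m) => [am|ma]; [left|right].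
  by apply: allpairs_f; rewrite mem_zball.
rewrite mulrC; apply: (allpairs_f (fun a q => (a, a * q))).
  by rewrite mem_zball.
rewrite mem_zball.
rewrite leq_divRL //; apply: leq_trans bn; rewrite abszM.
by rewrite leq_mul2l (ltnW ma) orbT.
Qed.

Section Density.
Variables (H : groupType) (e : seq (H * option nat)).
Variables (S : set H) (i0 i1 : 'I_(size e)).
Hypothesis coordP :
  forall u, exists! z : {ffun 'I_(size e) -> int}, is_coordinates u z.

Lemma coordinatesE (u : H) (z : {ffun 'I_(size e) -> int}) :
  is_coordinates u z -> coordinates e u = z.
Proof.
move=> uz; have [z' [z'P uniq]] := coordP u.
rewrite -(uniq z uz); apply/esym/uniq; exact: xgetI uz.
Qed.

Lemma coordinatesP (u : H) : is_coordinates u (coordinates e u).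
Proof. by have [z [zP _]] := coordP u; rewrite (coordinatesE zP). Qed.

Hypothesis i01 : i0 != i1.
Hypothesis order0 : (tnth (in_tuple e) i0).2 = None.
Hypothesis order1 : (tnth (in_tuple e) i1).2 = None.
Hypothesis S_dvd :
  forall u, S u -> (coordinates e u i0 %| coordinates e u i1)%Z.

Let update (z : {ffun 'I_(size e) -> int}) (a b : int) :
    {ffun 'I_(size e) -> int} :=
  [ffun i => if i == i0 then a else if i == i1 then b else z i].

Let value (z : {ffun 'I_(size e) -> int}) : H :=
  (\prod_i zexpg (tnth (in_tuple e) i).1 (z i))%g.

(** Entries at [i0] and [i1] are unbounded, so the updated vector is still admissible, and
    uniqueness makes it the coordinates of its product. *)
Let coordinates_update (u : H) (a b : int) :
  coordinates e (value (update (coordinates e u) a b)) =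
  update (coordinates e u) a b.
Proof.
apply: coordinatesE; split=> // i; rewrite ffunE.
case: eqP => [->|_]; first by rewrite order0.
case: eqP => [->|_]; first by rewrite order1.
by have [] := coordinatesP u.
Qed.

(* Exchanging the coordinates of [u] in [S] at [i0] and [i1] with an arbitrary
   pair in [-n, n]^2 injects S_n * [-n, n]^2 into (dividing pairs) * B_n. *)
Lemma card_dvd_ball (m n : nat) : (0 < m)%N -> finite_set (nball e n) ->
  (#|` fset_set (S `&` nball e n)| * n.*2.+1 <=
   (m.*2.+1 + (n %/ m).*2.+1) * #|` fset_set (nball e n)|)%N.
Proof.
move=> m0 fin.
have finS : finite_set (S `&` nball e n) by apply: finite_setIr.
have normP u : nball e n u <-> forall i, (`|coordinates e u i| <= n)%N.
  split=> [un i|un]; last by apply/bigmax_leqP.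
  by have /bigmax_leqP := un; apply.
pose swap (x : H * (int * int)) :=
  ((coordinates e x.1 i0, coordinates e x.1 i1),
   value (update (coordinates e x.1) x.2.1 x.2.2)).
pose dom := [seq (u, p) | u <- fset_set (S `&` nball e n),
  p <- [seq (a, b) | a <- zball n, b <- zball n]].
pose cod := [seq (p, u) | p <- dvd_pairs m n, u <- fset_set (nball e n)].
(* The pair records the two overwritten coordinates; [value] retains all the others and the two new
   entries. *)
have swap_inj : injective swap.
  move=> [u [a b]] [u' [a' b']] [uu0 uu1 vv].
  have := congr1 (coordinates e) vv; rewrite !coordinates_update => /ffunP upd.
  have := upd i0; rewrite !ffunE eqxx => ->.
  have := upd i1; rewrite !ffunE eq_sym (negPf i01) eqxx => ->.
  congr pair; have [_ ->] := coordinatesP u; have [_ ->] := coordinatesP u'.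
  apply: eq_bigr => i _; congr zexpg.
  case: (eqVneq i i0) => [->//|ii0]; case: (eqVneq i i1) => [->//|ii1].
  by have := upd i; rewrite !ffunE (negPf ii0) (negPf ii1).
have dom_uniq : uniq dom.
  apply: allpairs_uniq => [||[u p] [u' p'] _ _ [-> ->]//].
    exact: fset_uniq.
  apply: allpairs_uniq (zball_uniq _) (zball_uniq _) _.
  by move=> -[a b] [a' b'] _ _ [-> ->].
have : (size [seq swap x | x <- dom] <= size cod)%N.
  apply: uniq_leq_size; first by rewrite map_inj_uniq.
  move=> _ /mapP[_ /allpairsP[[u p] [uS pI ->]] ->].
  have /allpairsP[[a b] [+ + ->]] := pI; rewrite !mem_zball => an bn.
  move: uS; rewrite in_fset_set // => /set_mem[Su Bu].
  have Bn := (normP u).1 Bu.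
  apply: allpairs_f.
    by apply: mem_dvd_pairs => //; apply: S_dvd.
  rewrite in_fset_set //; apply/mem_set/normP => i.
  by rewrite coordinates_update ffunE; do 2!case: eqP => //.
(* The domain brings [n.*2.+1] twice and [dvd_pairs] brings it once; one copy cancels. *)
rewrite size_map !size_allpairs size_dvd_pairs !size_zball -mulnA.
by rewrite mulnCA leq_pmul2l.
Qed.

Lemma density_cvg0 (R : realType) :
  density e R S n @[n --> \oo] --> (0 : R).
Proof.
apply/cvgrPdist_le => eps eps0.
(* The 3 comes from [m * (2m + 2 + 2(n %/ m)) <= 2m^2 + 2m + 2n <= 6n <= 3(2n + 1)], valid once
   [m^2 <= n]. *)
have [m [m0 meps]] : exists m, (0 < m)%N /\ (3%:R / m%:R <= eps :> R).
  exists (Num.bound (3%:R / eps)).+1; split=> //.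
  rewrite ler_pdivrMr // mulrC -ler_pdivrMr //.
  rewrite (le_trans (ltW (archi_boundP _))) //.
    by rewrite divr_ge0 // ltW.
  by rewrite ler_nat.
near=> n; rewrite sub0r normrN ger0_norm; last by rewrite divr_ge0.
apply: le_trans meps; rewrite /density.
(* On an infinite set [fset_set] is empty, and division by zero makes the density 0, so the estimate
   holds without proving balls finite. *)
have [fin|inf] := pselect (finite_set (nball e n)); last first.
  rewrite (_ : fset_set (nball e n) = fset0).
    by rewrite cardfs0 invr0 mulr0 divr_ge0.
  by rewrite /fset_set; case: pselect.
have := card_dvd_ball m0 fin; set s := #|` _|; set t := #|` _| => st.
have nm : (m * m <= n)%N by near: n; exists (m * m)%N.
have [->|t0] := posnP t; first by rewrite invr0 mulr0 divr_ge0.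
rewrite ler_pdivrMr ?ltr0n // mulrAC ler_pdivlMr ?ltr0n // -!natrM ler_nat.
rewrite -(leq_pmul2r (ltn0Sn n.*2)) mulnAC.
apply: leq_trans (leq_mul st (leqnn m)) _; rewrite mulnAC [leqRHS]mulnAC.
rewrite leq_mul //; have := leq_divM n m; nia.
Unshelve. all: by end_near.
Qed.

End Density.

Unset Implicit Arguments.

Theorem theorem3p5 (R : realType) (G : groupType) (c : nat)
    (d : nat -> seq G)
    (B : forall i, set (quot (lcsN (equations G c 1) i.+1)))
    (b : nat -> seq (equations G c 1)) :
  infinite_set [set: G] ->
  finitely_generated G ->
  nilpotency_class G c ->
  lower_central_base_data d B b ->
  density (lc_base d b) R (SAT G c 1) n @[n --> \oo] --> (0 : R).
Proof.
move=> infG _ [nilG _] base; have [dP _ _ _ _] := base.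
have [c0 [t td t_inf]] := infinite_order_generator infG nilG dP.
have sys := coord_system_lc_base base nilG c0 t_inf.
have coordP := coord_system_coordinates sys.
have [_ [_ d1E]] := dP 1%N c0.
pose j := index t (d 1%N); pose p0 := (1%g : equations G c 1, @None nat).
have eE : exists s, lc_base d b =
    (var G c ord0, None) :: lc_level d b 1 ++ s.
  rewrite lc_baseE // /vars enum_ordSl enum_ord0 /=.
  by exists (flatten [seq lc_level d b i | i <- iota 2 c.-1]).
have je : (j.+1 < size (lc_base d b))%N.
  have [s ->] := eE; rewrite /= size_cat !size_map /= ltnS.
  by rewrite ltn_addr // index_mem.
(* This bound is an order in [equations]; [lcs_coef] equates it with the order of [t] in the
   abelianization of [G]. *)
have order_t : (nth p0 (lc_base d b) j.+1).2 = None.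
  have [s ->] := eE; rewrite /= nth_cat !size_map /= index_mem td.
  rewrite (nth_map 1%g) ?size_map ?index_mem //=.
  rewrite (nth_map 1%g) ?index_mem // nth_index //.
  rewrite -[RHS]t_inf; apply: eq_elt_order => n.
  rewrite -!gmulfXn !quot_proj_eq1; exact: lcs_coef.
(* The single variable occupies position 0, which shifts the [j]-th member of [d 1] to [j.+1]. *)
apply: (@density_cvg0 _ _ _ (Ordinal (ltn_trans (ltn0Sn j) je)) (Ordinal je)).
- exact: coordP.
- by [].
- by rewrite (tnth_nth p0) /=; have [s ->] := eE.
- by rewrite (tnth_nth p0).
move=> u Su; have /is_coordinatesE[adm uE] := coordinatesP coordP u.
rewrite -!(nth_fgraph_ord 0) /=; apply: (SAT_dvd c0 base td t_inf adm).
by rewrite -uE.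
Qed.
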